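(* Let $p\ge 3$ be a prime and let $m,\alpha,\beta\ge 1$ be integers with $2\nmid\alpha$. (i) If $\bar a_{2^m\alpha}(p)\equiv 0\pmod 2$, then for all integers $n,k\ge 0$ with $p\nmid(2n+1)$, $$\bar a_{2^m\alpha}\left(2p^{2k+1}n+p^{2k+1}\right)\equiv 0\pmod{2^{m+2}}.$$ (ii) If $\bar a_{2\beta+1}(p)\equiv 0\pmod 2$, then for all integers $n,k\ge 0$ with $p\nmid(2n+1)$, $$\bar a_{2\beta+1}\left(2p^{2k+1}n+p^{2k+1}\right)\equiv 0\pmod 4.$$
   Context: For integers $\ell\ge1$ write $f_\ell=\prod_{j\ge 1}(1-q^{\ell j})$. For a positive integer $s$, $\bar a_s(n)$ denotes the number of partitions of $n$ in which each odd part occurs in one of $s$ colors and the first occurrence of each part (parts of the same size but different colors being distinct) may be overlined. Equivalently, $$\sum_{n\ge0}\bar a_s(n)q^n=\frac{f_2^{3s-2}}{f_1^{2s}f_4^{s-1}}.$$ *)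

(* Defs.v *)
From mathcomp Require Import all_boot.

Set Implicit Arguments.
Unset Strict Implicit.
Unset Printing Implicit Defensive.

Definition ncolors (s j : nat) : nat := if odd j then s else 1.

(* A part of size at most n; the size is the first component plus one. *)
Definition cpart (s n : nat) : finType :=
  {j : 'I_n & 'I_(ncolors s j.+1)}.

Definition cpart_size (s n : nat) (x : cpart s n) : nat := (tag x).+1.

(* An overpartition is encoded by its multiplicity function and by the set of
   the parts whose first occurrence is overlined, which have to occur. In a
   partition of n, sizes and multiplicities are at most n, so that these bounds
   exclude nothing. *)
Definition is_overpartition (s n : nat)
    (x : {ffun cpart s n -> 'I_n.+1} * {set cpart s n}) : bool :=
  (\sum_(y : cpart s n) x.1 y * cpart_size y == n)
    && (x.2 \subset [set y | 0 < x.1 y]).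

Definition abar (s n : nat) : nat :=
  #|[set x | is_overpartition (s := s) (n := n) x]|.

(* Main.v *)
(* Write x_j = q^j / (1 - q^j). The generating function of abar_s is the product
   of (1 + 2 x_j)^s over odd j times the product of 1 + 2 x_j over even j.
   - For odd s, it is 1 + 2 sum_j x_j modulo 4.
   - For s = 2^m alpha, the odd factors multiply to
     1 + 2^(m+1) alpha sum_(j odd) (x_j + x_j^2) modulo 2^(m+2), while the even
     ones multiply to a series in q^2 that is 1 modulo 2; moreover x_j^2 is a
     series in q^2 modulo 2.
   In both cases the coefficient at an odd N is, up to the modulus, a multiple
   of 2 (resp. 2^(m+1)) times the number of divisors of N, which is even unless
   N is a square. Finally p^(2k+1) (2n+1) has odd valuation at p. *)
Require Import Defs.
From mathcomp Require Import all_boot.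
From mathcomp Require Import all_algebra ring.

Set Implicit Arguments.
Unset Strict Implicit.
Unset Printing Implicit Defensive.

(** * Congruences modulo an element of a commutative ring *)

Section Congruence.
Import GRing.Theory.
Local Open Scope ring_scope.
Variable R : comNzRingType.
Implicit Types r a b c x : R.

(** Stated over any commutative ring, to serve for [int] and [{poly int}] alike. *)
Definition congr_mod r a b := exists y, a = b + r * y.

Lemma congr_mod_refl r a : congr_mod r a a.
Proof. by exists 0; rewrite mulr0 addr0. Qed.

Lemma congr_mod_trans r b a c :
  congr_mod r a b -> congr_mod r b c -> congr_mod r a c.
Proof. by move=> [y ->] [z ->]; exists (z + y); ring. Qed.

Lemma congr_modD r a b a' b' :
  congr_mod r a b -> congr_mod r a' b' -> congr_mod r (a + a') (b + b').
Proof. by move=> [y ->] [z ->]; exists (y + z); ring. Qed.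

Lemma congr_modM r a b a' b' :
  congr_mod r a b -> congr_mod r a' b' -> congr_mod r (a * a') (b * b').
Proof. by move=> [y ->] [z ->]; exists (b * z + y * b' + r * y * z); ring. Qed.

Lemma congr_mod_scale c r a b :
  congr_mod r a b -> congr_mod (c * r) (c * a) (c * b).
Proof. by move=> [y ->]; exists y; ring. Qed.

Lemma congr_mod_sum r (I : Type) (s : seq I) (P : pred I) (F G : I -> R) :
  (forall i, P i -> congr_mod r (F i) (G i)) ->
  congr_mod r (\sum_(i <- s | P i) F i) (\sum_(i <- s | P i) G i).
Proof.
move=> FG; elim/big_ind2: _ => //; first exact: congr_mod_refl.
by move=> *; apply: congr_modD.
Qed.

Lemma congr_mod_prod r (I : Type) (s : seq I) (P : pred I) (F G : I -> R) :
  (forall i, P i -> congr_mod r (F i) (G i)) ->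
  congr_mod r (\prod_(i <- s | P i) F i) (\prod_(i <- s | P i) G i).
Proof.
move=> FG; elim/big_ind2: _ => //; first exact: congr_mod_refl.
by move=> *; apply: congr_modM.
Qed.

Lemma congr_modX r n a b : congr_mod r a b -> congr_mod r (a ^+ n) (b ^+ n).
Proof.
move=> ab; elim: n => [|n IH]; first by exists 0; rewrite !expr0; ring.
by rewrite !exprS; apply: congr_modM.
Qed.

(** Since [c] divides [r], the modulus [c * r] divides [r ^+ 2], so every product of two terms
    [r * u i] vanishes. *)
Lemma prod1D_congr c r (I : Type) (s : seq I) (P : pred I) (u : I -> R) :
  congr_mod c r 0 ->
  congr_mod (c * r) (\prod_(i <- s | P i) (1 + r * u i))
    (1 + r * \sum_(i <- s | P i) u i).
Proof.
move=> [t rE]; rewrite add0r in rE.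
elim/big_rec2: _ => [|i y1 y2 _ [z ->]]; first by exists 0; ring.
by exists (t * u i * y1 + z * (1 + r * u i)); rewrite rE; ring.
Qed.

Lemma expr1D_congr c r n x : congr_mod c r 0 ->
  congr_mod (c * r) ((1 + r * x) ^+ n) (1 + r * (n%:R * x)).
Proof.
move=> cr; have := prod1D_congr (index_enum 'I_n) xpredT (fun=> x) cr.
by rewrite big_const_ord iter_mulr_1 sumr_const card_ord -[x *+ n]mulr_natl.
Qed.

(** Repeated squaring, starting from the identity [(1 + 2x)^2 = 1 + 4(x + x^2)]. Each further
    squaring doubles the coefficient [2 ^+ m.+2], and the square of the whole non-constant part is
    divisible by the new modulus. *)
Lemma expr_pow2_congr m x :
  congr_mod (2 ^+ m.+3) ((1 + 2 * x) ^+ (2 ^ m.+1))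
    (1 + 2 ^+ m.+2 * (x + x ^+ 2)).
Proof.
elim: m => [|m [y IH]].
  by exists 0; rewrite expn1; ring.
rewrite expnSr exprM IH.
exists (y + 2 ^+ m * (x + x ^+ 2 + 2 * y) ^+ 2).
rewrite !exprS; ring.
Qed.

Lemma sqr_sum_congr (I : Type) (s : seq I) (P : pred I) (F : I -> R) :
  congr_mod 2 ((\sum_(i <- s | P i) F i) ^+ 2) (\sum_(i <- s | P i) F i ^+ 2).
Proof.
elim/big_rec2: _ => [|i y1 y2 _ [z Hz]]; first by exists 0; ring.
by exists (z + F i * y2); rewrite sqrrD Hz; ring.
Qed.

End Congruence.

(** * The truncated generating function of [abar] *)

Section GeneratingFunction.
Import GRing.Theory.
Local Open Scope ring_scope.

(* x_j truncated: a polynomial that agrees with q^j / (1 - q^j) up to q^n. *)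
Definition geom (n j : nat) : {poly int} := \sum_(k < n) 'X^(k.+1 * j).

Lemma coef_geom n j : (0 < n)%N -> (geom n j.+1)`_n = (j.+1 %| n)%N%:R.
Proof.
move=> n_gt0; rewrite coef_sum; under eq_bigr do rewrite coefXn.
case: (boolP (j.+1 %| n)%N) => [/dvdnP[k kE]|ndvd].
  have k_gt0 : (0 < k)%N by case: k kE n_gt0 => // ->.
  (* Exponents start at [j.+1], so the multiple [k] has index [k.-1]; it lies below the truncation
     because [k <= n]. *)
  have ltkn : (k.-1 < n)%N by rewrite prednK // kE leq_pmulr.
  rewrite (bigD1 (Ordinal ltkn)) //= prednK // {1}kE eqxx big1 ?addr0 // => i.
  rewrite -val_eqE /= => ik; rewrite {1}kE eqn_pmul2r //.
  by case: eqP => // ki; rewrite ki /= eqxx in ik.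
rewrite big1 // => i _; case: eqP => // nE.
by rewrite nE dvdn_mull in ndvd.
Qed.

(** Modulo 2, squaring acts termwise, and squares of monomials have even exponents. *)
Lemma coef_sqr_geom n j : odd n ->
  congr_mod 2 ((geom n j ^+ 2)`_n) 0.
Proof.
move=> odd_n.
have [y ->] := sqr_sum_congr (index_enum 'I_n) xpredT
  (fun k => 'X^(k.+1 * j) : {poly int}).
exists (y`_n); rewrite coefD mulr_natl coefMn mulr_natl; congr (_ + _).
rewrite coef_sum big1 // => i _; rewrite -exprM coefXn.
by case: eqP => // nE; rewrite nE muln2 odd_double in odd_n.
Qed.

(** Expanding the product chooses a multiplicity for every part. Each part that occurs contributes a
    factor 2, and these factors multiply to the number of sets of overlined parts. *)
Lemma abar_coef s n :
  (abar s n)%:R =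
    (\prod_(y : cpart s n) (1 + 2 * geom n (cpart_size y)))`_n.
Proof.
have factorE (y : cpart s n) : 1 + 2 * geom n (cpart_size y) =
    \sum_(k < n.+1) (2 ^+ (0 < k)%N : int) *: 'X^(k * cpart_size y).
  rewrite big_ord_recl /= mul0n expr0 scale1r; congr (_ + _).
  rewrite mulr_sumr; apply: eq_bigr => k _.
  by rewrite expr1 -mul_polyC rmorph_nat.
under eq_bigr do rewrite factorE.
rewrite bigA_distr_bigA coef_sum /=.
rewrite /abar -sum1dep_card natr_sum /=.
rewrite (eq_bigl (fun x : {ffun cpart s n -> 'I_n.+1} * {set cpart s n} =>
   (\sum_(y : cpart s n) x.1 y * cpart_size y == n)%N
    && (x.2 \in powerset [set y | (0 < x.1 y)%N]))); last first.
  by move=> x; rewrite /is_overpartition powersetE.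
rewrite -(pair_big_dep (fun f : {ffun cpart s n -> 'I_n.+1} =>
    (\sum_(y : cpart s n) f y * cpart_size y == n)%N)
  (fun f A => A \in powerset [set y | (0 < f y)%N]) (fun _ _ => 1)) /=.
rewrite big_mkcond; apply: eq_bigr => f _.
rewrite scaler_prod -!expr_sum coefZ coefXn eq_sym.
case: eqP => _; last by rewrite mulr0.
rewrite mulr1 sumr_const card_powerset natrX; congr (_ ^+ _).
rewrite -sum1_card [LHS]big_mkcond; apply: eq_bigr => y _; rewrite inE.
by case: (0 < _)%N.
Qed.

Lemma coef_congr k (P Q : {poly int}) n :
  congr_mod (2 ^+ k) P Q -> congr_mod (2 ^+ k) P`_n Q`_n.
Proof.
move=> [y ->]; exists y`_n.
by rewrite coefD -[2]/(2%:R) -natrX mulr_natl coefMn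
  -[_ *+ (2 ^ k)]mulr_natl natrX.
Qed.

Lemma modn_congr k n : congr_mod (2 ^+ k : int) n%:R 0 ->
  (n = 0 %[mod 2 ^ k])%N.
Proof.
move=> [y nE]; rewrite mod0n; apply/eqP; change (2 ^ k %| n)%N.
have : ((2 ^+ k : int) %| n%:Z)%Z.
  by apply/dvdzP; exists y; rewrite -natz nE; ring.
by rewrite dvdzE abszX.
Qed.

Definition even_supported (P : {poly int}) := forall i, odd i -> P`_i = 0.

Lemma even_supportedM P Q :
  even_supported P -> even_supported Q -> even_supported (P * Q).
Proof.
move=> eP eQ i odd_i; rewrite coefM big1 // => j _.
case: (boolP (odd j)) => [/eP ->|ev_j]; first by rewrite mul0r.
by rewrite eQ ?mulr0 // oddB ?odd_i ?(negPf ev_j) // -ltnS.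
Qed.

Lemma even_supported_factor n j : ~~ odd j -> even_supported (1 + 2 * geom n j).
Proof.
move=> ev_j i odd_i; rewrite coefD mulr_natl coefMn coef1 coef_sum big1.
  by case: i odd_i.
move=> k _; rewrite coefXn; case: eqP => // iE.
by rewrite iE oddM (negPf ev_j) andbF in odd_i.
Qed.

Lemma abar_coef_size s n :
  (abar s n)%:R =
    (\prod_(j < n) (1 + 2 * geom n j.+1) ^+ ncolors s j.+1)`_n.
Proof.
rewrite abar_coef; congr ((polyseq _)`_n).
under [RHS]eq_bigr => j _ do rewrite -iter_mulr_1 -big_const_ord.
by rewrite sig_big_dep.
Qed.

End GeneratingFunction.

(** * Parity of the number of divisors of a nonsquare *)

Lemma even_num_divisors N : (forall d, d * d != N) -> 0 < N ->
  ~~ odd (\sum_(j < N) (j.+1 %| N)).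
Proof.
move=> nsq N_gt0.
(* d |-> N / d exchanges the divisors below and above the square root of N. *)
pose small := [set j : 'I_N | (j.+1 %| N) && (j.+1 * j.+1 < N)].
pose large := [set j : 'I_N | (j.+1 %| N) && (N < j.+1 * j.+1)].
have cod_lt (j : 'I_N) : (N %/ j.+1).-1 < N.
  by rewrite prednK ?leq_div // divn_gt0.
pose cod j := Ordinal (cod_lt j).
have codS j : (cod j).+1 = N %/ j.+1 by rewrite /= prednK // divn_gt0.
have codM (j : 'I_N) : j.+1 %| N -> (cod j).+1 * j.+1 = N.
  by move=> jN; rewrite codS divnK.
have cod_dvd (j : 'I_N) : j.+1 %| N -> (cod j).+1 %| N.
  by move=> /codM jE; rewrite -[X in _ %| X]jE; apply: dvdn_mulr.
have codK (j : 'I_N) : j.+1 %| N -> cod (cod j) = j.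
  move=> jN; apply/val_inj/succn_inj.
  by rewrite codS -[X in X %/ _](codM _ jN) mulKn.
have cod_cmp (j : 'I_N) : j.+1 %| N ->
    ((cod j).+1 * (cod j).+1 < N) = (N < j.+1 * j.+1).
  move=> jN; rewrite -[X in _ * _ < X](codM _ jN) ltn_pmul2l //.
  by rewrite -[X in _ = (X < _)](codM _ jN) ltn_pmul2r.
have largeE : large = cod @: small.
  apply/setP => j; apply/idP/imsetP => [|[i]]; rewrite inE => /andP[jN jlt].
    by exists (cod j); rewrite ?codK // inE cod_dvd // cod_cmp.
  by move=> ->; rewrite inE cod_dvd // -cod_cmp ?cod_dvd // codK.
(* No divisor is missed, because [N] is not a square. *)
have -> : \sum_(j < N) (j.+1 %| N) = #|small :|: large|.
  rewrite -sum1_card [RHS]big_mkcond; apply: eq_bigr => j _; rewrite !inE.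
  by case: (_ %| _) => //=; have := nsq j.+1; case: ltngtP.
rewrite cardsU (_ : small :&: large = set0); last first.
  apply/setP => j; rewrite !inE; case: (_ %| _) => //=.
  by case: ltngtP.
rewrite cards0 subn0 largeE card_in_imset ?addnn ?odd_double //.
move=> i j; rewrite !inE => /andP[iN _] /andP[jN _] ij.
by rewrite -(codK i) // ij codK.
Qed.

Import GRing.Theory.
Local Open Scope ring_scope.

Lemma num_divisors_congr N : (forall d, d * d != N)%N -> (0 < N)%N ->
  congr_mod (2 : int) (\sum_(j < N) (j.+1 %| N)%N%:R) 0.
Proof.
move=> nsq N_gt0; have := even_num_divisors nsq N_gt0.
rewrite -dvdn2 => /dvdnP[q qE].
by exists q%:R; rewrite -natr_sum qE natrM; ring.
Qed.

Lemma nonsquare_coef_sum_geom N : odd N -> (forall d, d * d != N)%N ->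
  congr_mod 2 (\sum_(j < N) (geom N j.+1)`_N) 0.
Proof.
move=> odd_N nsq; have N_gt0 := odd_gt0 odd_N.
by under eq_bigr do rewrite coef_geom //; apply: num_divisors_congr.
Qed.

(** * The two congruences at odd nonsquare arguments *)

Lemma abar_odd_colors s N : odd s -> odd N -> (forall d, d * d != N)%N ->
  (abar s N = 0 %[mod 4])%N.
Proof.
move=> odd_s odd_N nsq; have N_gt0 := odd_gt0 odd_N.
have r2 : congr_mod (2 : {poly int}) 2 0 by exists 1; ring.
have cong4 : congr_mod (2 ^+ 2)
    (\prod_(j < N) (1 + 2 * geom N j.+1) ^+ ncolors s j.+1)
    (1 + 2 * \sum_(j < N) geom N j.+1).
  (* With [c = r = 2], linearize first each power, then the product over sizes. *)
  rewrite expr2; apply: congr_mod_trans.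
    apply: congr_mod_prod => j _; exact: expr1D_congr r2.
  apply: congr_mod_trans (prod1D_congr _ _ _ r2) _.
  apply: congr_modD; first exact: congr_mod_refl.
  apply/congr_mod_scale/congr_mod_sum => j _.
  (* The number of colors is odd, hence 1 plus twice its half. *)
  exists ((ncolors s j.+1)./2%:R * geom N j.+1).
  have odd_c : odd (ncolors s j.+1) by rewrite /ncolors; case: ifP.
  rewrite -{1}(odd_double_half (ncolors s j.+1)) odd_c -muln2 natrD natrM /=.
  by ring.
apply: (@modn_congr 2); rewrite abar_coef_size.
apply: congr_mod_trans (coef_congr N cong4) _.
have [y yE] := nonsquare_coef_sum_geom odd_N nsq.
exists y; rewrite coefD coef1 mulr_natl coefMn coef_sum yE.
rewrite (gtn_eqF N_gt0) /=; ring.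
Qed.

(** The exponent [m.+1] provides at least one squaring, from which the shape [x + x^2] arises. *)
Lemma abar_pow2_colors m alpha N : odd N -> (forall d, d * d != N)%N ->
  (abar (2 ^ m.+1 * alpha) N = 0 %[mod 2 ^ m.+3])%N.
Proof.
move=> odd_N nsq; have N_gt0 := odd_gt0 odd_N.
apply: modn_congr; rewrite abar_coef_size.
rewrite (bigID (fun j : 'I_N => odd j.+1)) /=.
set A := \prod_(i | _) _; set B := \prod_(i | _) _.
pose u (j : 'I_N) := geom N j.+1 + geom N j.+1 ^+ 2.
pose U := \sum_(j < N | odd j.+1) u j.
have r2 : congr_mod (2 : {poly int}) (2 ^+ m.+2) 0.
  by exists (2 ^+ m.+1); rewrite add0r exprS.
(* Built backwards: the power [2 ^ m.+1] is taken in each factor, then the product over odd sizes,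
   then the power [alpha]. *)
have [Y AE] : congr_mod (2 ^+ m.+3) A (1 + 2 ^+ m.+2 * (alpha%:R * U)).
  rewrite [2 ^+ m.+3]exprS; apply: congr_mod_trans (expr1D_congr _ _ r2).
  apply: congr_mod_trans (congr_modX _ (prod1D_congr _ _ _ r2)).
  rewrite -prodrXl; apply: congr_mod_prod => j odd_j.
  by rewrite /ncolors /= odd_j exprM -exprS; apply/congr_modX/expr_pow2_congr.
have BE (j : 'I_N) : ~~ odd j.+1 ->
    (1 + 2 * geom N j.+1) ^+ ncolors (2 ^ m.+1 * alpha) j.+1 =
    1 + 2 * geom N j.+1.
  by move=> ev_j; rewrite /ncolors (negPf ev_j) expr1.
have evB : even_supported B.
  rewrite /B; elim/big_ind: _ => [[]//||j ev_j].
  - by move=> i; rewrite coef1; case: i.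
  - exact: even_supportedM.
  - by rewrite BE //; apply: even_supported_factor.
have [Z {}BE] : congr_mod 2 B 1.
  have prod1 : \prod_(j < N | ~~ odd j.+1) 1 = 1 :> {poly int} by rewrite big1.
  rewrite -[X in congr_mod _ _ X]prod1.
  apply: congr_mod_prod => j ev_j; rewrite BE //.
  by exists (geom N j.+1).
have AB : congr_mod (2 ^+ m.+3) (A * B) (B + 2 ^+ m.+2 * (alpha%:R * U)).
  exists (Y * B + alpha%:R * U * Z).
  by rewrite AE mulrDl mulrDl {2}BE [2 ^+ m.+3]exprS; ring.
apply: congr_mod_trans (coef_congr N AB) _.
have -> : 2 ^+ m.+2 * (alpha%:R * U) = U *+ (2 ^ m.+2 * alpha).
  by rewrite -[RHS]mulr_natl natrM natrX mulrA.
rewrite coefD evB // add0r coefMn.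
(* The sum may run over all sizes: an odd [N] has no even divisors, and the squares contribute 0
   modulo 2. *)
have [y UE] : congr_mod 2 U`_N 0.
  have := nonsquare_coef_sum_geom odd_N nsq; apply: congr_mod_trans.
  rewrite coef_sum big_mkcond; apply: congr_mod_sum => j _.
  case: ifPn => [odd_j|ev_j].
    rewrite coefD -[X in congr_mod _ _ X]addr0.
    by apply: congr_modD (coef_sqr_geom _ odd_N); apply: congr_mod_refl.
  rewrite coef_geom //; case: (boolP (_ %| _)%N) => [jN|_]; last first.
    exact: congr_mod_refl.
  by rewrite (dvdn_odd jN) in ev_j.
exists (alpha%:R * y); rewrite UE -[LHS]mulr_natl natrM natrX [2 ^+ m.+3]exprS.
by ring.
Qed.

(** * Arguments of odd valuation at [p], and the conclusion *)

Lemma odd_logn_nonsquare p N : odd (logn p N) -> forall d, (d * d != N)%N.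
Proof.
move=> odd_log d; apply: contraTneq odd_log => <-.
by rewrite mulnn lognX mul2n odd_double.
Qed.

Local Close Scope ring_scope.

Theorem theorem1p1 (p m alpha beta : nat)
    (p_prime : prime p) (p_ge3 : 3 <= p)
    (m_ge1 : 1 <= m) (alpha_ge1 : 1 <= alpha) (beta_ge1 : 1 <= beta)
    (alpha_odd : ~~ (2 %| alpha)) :
  (abar (2 ^ m * alpha) p = 0 %[mod 2] ->
    forall n k : nat, ~~ (p %| 2 * n + 1) ->
      abar (2 ^ m * alpha) (2 * p ^ (2 * k + 1) * n + p ^ (2 * k + 1)) = 0
        %[mod 2 ^ (m + 2)])
  /\
  (abar (2 * beta + 1) p = 0 %[mod 2] ->
    forall n k : nat, ~~ (p %| 2 * n + 1) ->
      abar (2 * beta + 1) (2 * p ^ (2 * k + 1) * n + p ^ (2 * k + 1)) = 0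
        %[mod 4]).
Proof.
have odd_p : odd p by case/even_prime: p_prime p_ge3 => [->|].
have argE n k : 2 * p ^ (2 * k + 1) * n + p ^ (2 * k + 1) =
    p ^ (2 * k + 1) * (2 * n + 1).
  by rewrite mulnDr muln1 mulnCA mulnA.
have odd_arg n k : odd (p ^ (2 * k + 1) * (2 * n + 1)).
  by rewrite oddM oddX odd_p orbT addn1 mul2n /= odd_double.
have nonsquare n k : ~~ (p %| 2 * n + 1) ->
    forall d, d * d != p ^ (2 * k + 1) * (2 * n + 1).
  move=> pn; apply: (@odd_logn_nonsquare p).
  rewrite lognM ?expn_gt0 ?addn_gt0 ?orbT ?prime_gt0 // pfactorK //.
  rewrite [logn p (2 * n + 1)]lognE (negPf pn) !andbF addn0.
  by rewrite addn1 mul2n /= odd_double.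
split=> _ n k pn; rewrite argE.
  case: m m_ge1 => // m _; rewrite addn2.
  exact: abar_pow2_colors (nonsquare _ _ pn).
apply: abar_odd_colors (nonsquare _ _ pn) => //.
by rewrite addn1 mul2n /= odd_double.
Qed.
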